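(* Let $(e_n,e_n^\sharp)$ be a filter basis system for a Banach space $X$. Then the following are equivalent: (1) the functionals $e_n^\sharp$ are continuous; (2) the sequence $(e_n)$ is minimal; (3) the smallest filter compatible with $(e_n,e_n^\sharp)$ is analytic; (4) there is an analytic filter compatible with $(e_n,e_n^\sharp)$; (5) there is a Borel filter compatible with $(e_n,e_n^\sharp)$.
   Context: All Banach spaces are real. All filters $\mathcal F$ on $\mathbb N$ are assumed proper ($\emptyset\notin\mathcal F$) and to contain every cofinite subset of $\mathbb N$. A sequence $(x_n)$ converges along $\mathcal F$ to $x$ if $\{n\in\mathbb N : \|x_n-x\|<\varepsilon\}\in\mathcal F$ for all $\varepsilon>0$. A sequence $(e_n)$ in $X$ is an $\mathcal F$-basis for $X$ if for every $x\in X$ there is a unique $(a_n)\in\mathbb R^{\mathbb N}$ such that the partial sums $\sum_{n=1}^m a_ne_n$ converge to $x$ along $\mathcal F$ (in $m$); the associated biorthogonal functionals are then $x\mapsto a_k$. A biorthogonal system $(e_n,e_n^\sharp)$ in $X$ consists of vectors $e_n\in X$ and (possibly discontinuous) linear functionals $e_n^\sharp\colon X\to\mathbb R$ with $e_k^\sharp(e_n)=\delta_{k,n}$. It is a filter basis system for $X$ if there is a filter $\mathcal F$ such that $(e_n)$ is an $\mathcal F$-basis for $X$ with associated biorthogonal functionals $e_n^\sharp$; any such $\mathcal F$ is called compatible with $(e_n,e_n^\sharp)$. Every filter basis system has a smallest (with respect to inclusion) compatible filter. The sequence $(e_n)$ is minimal if for all $k$, $e_k\notin[e_n]_{n\ne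 k}$, where $[\cdot]$ denotes the norm-closed linear span. A filter is analytic (respectively Borel) if it is so as a subset of $\mathcal P(\mathbb N)=\{0,1\}^{\mathbb N}$ with the Cantor space topology. *)

(* Defs.v *)
From HB Require Import structures.
From mathcomp Require Import all_boot all_order all_algebra.
From mathcomp Require Import all_classical all_reals all_analysis.

Set Implicit Arguments.
Unset Strict Implicit.
Unset Printing Implicit Defensive.

Import Order.TTheory GRing.Theory Num.Theory.
Import numFieldNormedType.Exports.

Local Open Scope classical_set_scope.
Local Open Scope ring_scope.

Definition filter_on_nat (F : set_system nat) : Prop :=
  ProperFilter F /\ (forall A : set nat, finite_set (~` A) -> F A).

Definition partial_sum (R : realType) (X : completeNormedModType R)
    (e : nat -> X) (a : nat -> R) (m : nat) : X :=
  \sum_(n < m.+1) a n *: e n.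

Definition filter_basis (R : realType) (X : completeNormedModType R)
    (F : set_system nat) (e : nat -> X) : Prop :=
  forall x : X, exists! a : nat -> R, partial_sum e a @ F --> x.

(* [{scalar X}] is the type of linear functionals, with no continuity. *)
Definition biorthogonal (R : realType) (X : completeNormedModType R)
    (e : nat -> X) (esharp : nat -> {scalar X}) : Prop :=
  forall k n : nat, esharp k (e n) = (k == n)%:R.

Definition compatible (R : realType) (X : completeNormedModType R)
    (e : nat -> X) (esharp : nat -> {scalar X}) (F : set_system nat) : Prop :=
  [/\ filter_on_nat F, filter_basis F e &
      forall (x : X) (a : nat -> R),
        partial_sum e a @ F --> x -> forall k, esharp k x = a k].

Definition filter_basis_system (R : realType) (X : completeNormedModType R)
    (e : nat -> X) (esharp : nat -> {scalar X}) : Prop :=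
  biorthogonal e esharp /\ exists F : set_system nat, compatible e esharp F.

Definition smallest_compatible (R : realType) (X : completeNormedModType R)
    (e : nat -> X) (esharp : nat -> {scalar X}) (F : set_system nat) : Prop :=
  compatible e esharp F /\
  forall G : set_system nat, compatible e esharp G -> F `<=` G.

Definition linear_span (R : realType) (X : completeNormedModType R)
    (A : set X) : set X :=
  [set x | exists (n : nat) (c : 'I_n -> R) (v : 'I_n -> X),
     (forall i, A (v i)) /\ x = \sum_(i < n) c i *: v i].

Definition minimal_sequence (R : realType) (X : completeNormedModType R)
    (e : nat -> X) : Prop :=
  forall k : nat, ~ closure (linear_span [set e n | n in [set n | n <> k]]) (e k).

Definition baire_space : Type := prod_topology (fun _ : nat => nat).

HB.instance Definition _ := Topological.on baire_space.

Definition analytic_set (T : topologicalType) (A : set T) : Prop :=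
  A = set0 \/ exists f : baire_space -> T, continuous f /\ range f = A.

Definition borel_set (T : topologicalType) (A : set T) : Prop :=
  <<s [set U : set T | open U] >> A.

(* The image of [F] in [cantor_space] when a subset of [nat] is identified with
   its characteristic function. *)
Definition in_cantor (F : set_system nat) : set cantor_space :=
  [set x : cantor_space | F [set n | x n]].

Definition analytic_filter (F : set_system nat) : Prop :=
  analytic_set (in_cantor F).

Definition borel_filter (F : set_system nat) : Prop :=
  borel_set (in_cantor F).

(* Main.v *)
(* A linear functional whose graph is cut out by an analytic filter is continuous:
   if F is analytic, then {x | |e#_k x| <= N} is a projection of a closed subset of
   baire_space * X (the parameters are the coefficients of the expansion and
   witnesses of its convergence along F), so it is comeager in a nonempty open set
   as soon as it is nonmeager.  By the Baire category theorem this happens for some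
   N, and then e#_k is bounded near 0, as in Pettis' lemma.
   Conversely, continuity makes the smallest compatible filter, generated by the
   sets {m | |x - P_m x| < eps}, analytic, and makes every larger filter compatible.
   An analytic filter F lies in a Borel one: by Lusin separation, each Borel B
   containing F contains a Borel B' containing F such that x, y in B' and
   x /\ y <= z imply z in B; the intersection of the iterates of this shrinking,
   started at the nonempty sets, is a filter. *)
Require Import Defs.
From mathcomp Require Import all_boot all_order all_algebra.
From mathcomp Require Import all_classical all_reals all_analysis.
From mathcomp Require Import lra.

Set Implicit Arguments.
Unset Strict Implicit.
Unset Printing Implicit Defensive.

Import Order.TTheory GRing.Theory Num.Theory.
Import numFieldNormedType.Exports.

Local Open Scope classical_set_scope.
Local Open Scope ring_scope.

(** * Continuity and the Baire space *)

Lemma continuous_to_prod (S : topologicalType) (K : nat -> topologicalType)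
    (f : S -> prod_topology K) :
  (forall i, continuous (fun s => f s i)) -> continuous f.
Proof.
move=> cf s; apply/cvg_sup => i.
move=> U [B [[C oC <-] /= Cfs] BU].
apply: filterS BU _ => /=.
apply: (cf i s); exact: open_nbhs_nbhs.
Qed.

Lemma coord_continuous_prod (K : nat -> topologicalType) (i : nat) :
  continuous (fun f : prod_topology K => f i).
Proof. exact: proj_continuous. Qed.

Lemma continuous_coord (S : topologicalType) (K : nat -> topologicalType)
    (u : S -> prod_topology K) (i : nat) :
  continuous u -> continuous (fun s => u s i).
Proof.
move=> cu s.
exact: (@continuous_comp _ _ _ u (fun f : prod_topology K => f i) s (cu s)
  (@coord_continuous_prod K i (u s))).
Qed.

Lemma continuous_compose (S T U : topologicalType) (g : T -> U) (f : S -> T) :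
  continuous g -> continuous f -> continuous (g \o f).
Proof. by move=> cg cf s; apply: continuous_comp; [exact: cf|exact: cg]. Qed.

Lemma continuous_pair (S T U : topologicalType) (f : S -> T) (g : S -> U) :
  continuous f -> continuous g -> continuous (fun s => (f s, g s)).
Proof. by move=> cf cg s; apply: cvg_pair; [exact: cf|exact: cg]. Qed.

Definition agree (n : nat) (b c : baire_space) : Prop :=
  forall i, (i < n)%N -> c i = b i.

Lemma agree_nbhs (b : baire_space) (n : nat) : nbhs b (agree n b).
Proof.
elim: n => [|n IH]; first by apply: (@filterS _ (nbhs b) _ setT) => //; exact: filterT.
have : nbhs b [set c : baire_space | c n = b n].
  by apply: (@coord_continuous_prod (fun=> nat) n b [set k | k = b n]).
move=> H; apply: filterS (filterI IH H) => c [/= H1 H2] i.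
by rewrite ltnS leq_eqVlt => /orP[/eqP->//|]; apply: H1.
Qed.

(** The filter generated by the sets [agree n b] converges to [b] in every coordinate, hence in the
    product topology, so it refines [nbhs b]. *)
Lemma nbhs_agree (b : baire_space) (U : set baire_space) :
  nbhs b U -> exists n, agree n b `<=` U.
Proof.
pose F := filter_from [set: nat] (fun n => agree n b).
have FF : Filter F.
  apply: filter_from_filter; first by exists 0%N.
  move=> i j _ _; exists (maxn i j) => // c H; split=> k ki; apply: H;
  by rewrite (leq_trans ki)// (leq_maxl, leq_maxr).
have : F --> b.
  apply/cvg_sup => i V [B [[C oC <-] /= Cb] BV].
  exists i.+1 => // c /(_ i (ltnSn i)) cb; apply: BV => /=.
  by rewrite /= cb.
by move=> /[apply] -[n _ nU]; exists n.
Qed.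

Lemma agree_trans n (a b c : baire_space) : agree n a b -> agree n b c -> agree n a c.
Proof. by move=> ab bc i ni; rewrite bc// ab. Qed.

Lemma agree_sym n (b c : baire_space) : agree n b c -> agree n c b.
Proof. by move=> bc i /bc. Qed.

Lemma agree_le m n (b c : baire_space) : (m <= n)%N -> agree n b c -> agree m b c.
Proof. by move=> mn bc i im; apply: bc; apply: leq_trans mn. Qed.

Lemma continuous_locally_constant (T : topologicalType) (f : baire_space -> T) (n : nat) :
  (forall b c, agree n b c -> f c = f b) -> continuous f.
Proof.
move=> H b U /nbhs_singleton Ub; apply: filterS (agree_nbhs b n) => c /H bc.
by rewrite /= bc.
Qed.

(** The pairing [pickle] packs a sequence of points of the Baire space into one, so that a single
    witness can carry countably many. *)
Definition slice (j : nat) (b : baire_space) : baire_space :=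
  fun i => b (pickle (j, i)).

Definition unslice (c : nat -> baire_space) : baire_space :=
  fun n => if unpickle n is Some (j, i) then c j i else 0%N.

Lemma unsliceK c j : slice j (unslice c) = c j.
Proof. by apply/funext => i; rewrite /slice /unslice pickleK. Qed.

Definition tail_seq (b : baire_space) : baire_space := fun i => b i.+1.

Definition cons_seq (k : nat) (b : baire_space) : baire_space :=
  fun i => if i is i'.+1 then b i' else k.

Lemma reindex_continuous (h : nat -> nat) :
  continuous ((fun b i => b (h i)) : baire_space -> baire_space).
Proof.
apply: continuous_to_prod => i.
exact: (@coord_continuous_prod (fun=> nat) (h i)).
Qed.

Lemma slice_continuous j : continuous (slice j).
Proof. exact: (@reindex_continuous (fun i => pickle (j, i))). Qed.

Lemma tail_seq_continuous : continuous tail_seq.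
Proof. exact: (@reindex_continuous S). Qed.

(** Parities map the Baire space continuously onto the Cantor space, so points of the latter can be
    carried as codes in the former. *)
Definition odds (b : baire_space) : cantor_space := fun i => odd (b i).

Lemma odds_continuous : continuous odds.
Proof.
apply: continuous_to_prod => i.
by apply: (@continuous_locally_constant _ _ i.+1) => b c bc; rewrite /odds bc.
Qed.

Lemma odds_surjective (x : cantor_space) : exists b, odds b = x.
Proof. by exists (fun i => nat_of_bool (x i)); apply/funext => i; rewrite /odds oddb. Qed.

(** * Nonempty closed sets as retracts of the Baire space *)

Section retraction.
Variable C : set baire_space.
Hypothesis clC : closed C.

Let tree (s : seq nat) : Prop := exists2 b, C b & forall i, (i < size s)%N -> b i = nth 0%N s i.

Let next (s : seq nat) (k : nat) : nat :=
  if pselect (tree (rcons s k)) then k else xget 0%N [set m | tree (rcons s m)].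

(* The retraction follows [b] as long as it stays in the tree of [C], and picks some
   extension within the tree otherwise. *)
Let path (b : baire_space) : nat -> seq nat :=
  fix path n := if n is n'.+1 then rcons (path n') (next (path n') (b n')) else [::].

Let size_path b n : size (path b n) = n.
Proof. by elim: n => //= n IH; rewrite size_rcons IH. Qed.

Let tree_next s k : tree s -> tree (rcons s (next s k)).
Proof.
move=> [b Cb bs]; rewrite /next; case: pselect => //= _.
apply: (@xgetPex _ 0%N [set m | tree (rcons s m)]).
exists (b (size s)), b => // i; rewrite size_rcons ltnS nth_rcons leq_eqVlt => /orP[/eqP->|H].
  by rewrite ltnn eqxx.
by rewrite H bs.
Qed.

Let retract (b : baire_space) : baire_space := fun n => next (path b n) (b n).

Let nth_path b n i : (i < n)%N -> nth 0%N (path b n) i = retract b i.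
Proof.
elim: n => //= n IH; rewrite ltnS leq_eqVlt nth_rcons size_path => /orP[/eqP->|H].
  by rewrite ltnn eqxx.
by rewrite H IH.
Qed.

Let path_agree n b c : agree n b c -> path c n = path b n.
Proof.
elim: n => //= n IH H; rewrite IH ?H//; exact: agree_le H.
Qed.

Let path_fix b n : C b -> path b n = mkseq b n.
Proof.
move=> Cb; elim: n => //= n ->.
rewrite mkseqS; congr rcons.
rewrite /next; case: pselect => // H; exfalso; apply: H.
exists b => // i; rewrite size_rcons size_mkseq => ni.
by rewrite -mkseqS nth_mkseq.
Qed.

(** Each coordinate of the retraction depends on finitely many entries, and the retraction fixes
    [C]. Initial segments of its values stay in the tree, so its values are limits of points of
    [C]. *)
Lemma closed_continuous_image : C !=set0 ->
  exists r : baire_space -> baire_space, continuous r /\ range r = C.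
Proof.
move=> [b0 Cb0]; exists retract; split.
  apply: continuous_to_prod => i.
  apply: (@continuous_locally_constant _ _ i.+1) => b c bc.
  rewrite /retract (path_agree (agree_le (leqnSn _) bc)).
  by congr next; apply: bc.
rewrite eqEsubset; split=> [_ [b _ <-]|b Cb].
  apply: clC => U /nbhs_agree[n nU].
  have : tree (path b n).
    by elim: n {nU} => [|n IH]; [exists b0|apply: tree_next].
  move=> [c Cc cn]; exists c; split => //; apply: nU => i ni.
  by rewrite cn ?size_path// nth_path.
exists b => //; apply/funext => n; rewrite /retract.
have := path_fix n.+1 Cb; rewrite /= => /(congr1 (fun s => nth 0%N s n)).
by rewrite nth_rcons size_path ltnn eqxx nth_mkseq.
Qed.

End retraction.

(** * Projections of closed sets *)

Lemma continuous_closed_preimage (S T : topologicalType) (f : S -> T) (D : set T) :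
  continuous f -> closed D -> closed (f @^-1` D).
Proof. by move=> /continuous_closedP; apply. Qed.

Lemma continuous_prod_map (S T S' T' : topologicalType) (f : S -> S') (g : T -> T') :
  continuous f -> continuous g ->
  continuous (fun p : S * T => (f p.1, g p.2)).
Proof.
move=> cf cg p; apply: cvg_pair.
  by apply: continuous_comp; [exact: cvg_fst|exact: cf].
by apply: continuous_comp; [exact: cvg_snd|exact: cg].
Qed.

Lemma fst_continuous (S T : topologicalType) : continuous (@fst S T).
Proof. by move=> p; exact: cvg_fst. Qed.

Lemma snd_continuous (S T : topologicalType) : continuous (@snd S T).
Proof. by move=> p; exact: cvg_snd. Qed.

Lemma closed_bool_eq (S : topologicalType) (u v : S -> bool) :
  continuous u -> continuous v -> closed [set s | u s = v s].
Proof.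
move=> cu cv; rewrite (_ : [set s | u s = v s] =
  (u @^-1` [set true] `&` v @^-1` [set true]) `|`
  (u @^-1` [set false] `&` v @^-1` [set false])).
  by apply: closedU; apply: closedI; apply: continuous_closed_preimage => //;
    exact: discrete_closed.
apply/seteqP; split=> s /=; first by case: (u s) => <-; [left|right].
by move=> [[-> ->]|[-> ->]].
Qed.

(* For Polish [T] these are the analytic sets, including the empty one. *)
Definition suslin (T : topologicalType) (A : set T) : Prop :=
  exists C : set (baire_space * T), closed C /\ A = [set x | exists b, C (b, x)].

Lemma closed_suslin (T : topologicalType) (A : set T) : closed A -> suslin A.
Proof.
move=> clA; exists (snd @^-1` A); split.
  by apply: continuous_closed_preimage => //; exact: snd_continuous.
by apply/seteqP; split => x /=; [exists (fun=> 0%N)|case].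
Qed.

Lemma bigcap_suslin (T : topologicalType) (A : nat -> set T) :
  (forall n, suslin (A n)) -> suslin (\bigcap_n A n).
Proof.
move=> /choice[C CA].
exists (\bigcap_n ((fun p : baire_space * T => (slice n p.1, p.2)) @^-1` C n)); split.
  apply: closed_bigI => n _; have [clC _] := CA n.
  apply: continuous_closed_preimage clC.
  by apply: (@continuous_prod_map _ _ _ _ (slice n) id);
    [exact: slice_continuous|move=> ?; exact: cvg_id].
apply/seteqP; split => x /=.
  move=> H; have /choice[b Cb] : forall n, exists b, C n (b, x).
    by move=> n; have := H n I; rewrite (CA n).2.
  by exists (unslice b) => n _ /=; rewrite unsliceK.
by move=> [b H] n _; rewrite (CA n).2; exists (slice n b); exact: H.
Qed.

(** The first entry of the witness names a set of the family and its tail is a witness for that set.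
    As an intersection over [n] of implications with clopen premise, the condition is closed. *)
Lemma bigcup_suslin (T : topologicalType) (A : nat -> set T) :
  (forall n, suslin (A n)) -> suslin (\bigcup_n A n).
Proof.
move=> /choice[C CA].
exists (\bigcap_n ((fun p : baire_space * T => p.1 0%N) @^-1` [set k | k <> n] `|`
  (fun p : baire_space * T => (tail_seq p.1, p.2)) @^-1` C n)); split.
  apply: closed_bigI => n _; have [clC _] := CA n; apply: closedU.
    apply: continuous_closed_preimage; last exact: discrete_closed.
    by apply: (@continuous_coord _ (fun=> nat) fst 0%N); exact: fst_continuous.
  apply: continuous_closed_preimage clC.
  by apply: (@continuous_prod_map _ _ _ _ tail_seq id);
    [exact: tail_seq_continuous|move=> ?; exact: cvg_id].
apply/seteqP; split => x /=.
  move=> [n _]; rewrite (CA n).2 => -[b Cb]; exists (cons_seq n b) => m _ /=.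
  have [<-|/eqP nm] := eqVneq n m; last by left.
  by right; exact: Cb.
move=> [b H]; exists (b 0%N) => //; rewrite (CA _).2; exists (tail_seq b).
by have [] := H (b 0%N) I.
Qed.

Lemma closed_graph (f : baire_space -> cantor_space) :
  continuous f -> closed [set p : baire_space * cantor_space | f p.1 = p.2].
Proof.
move=> cf; rewrite (_ : [set _ | _] =
    \bigcap_i [set p : baire_space * cantor_space | f p.1 i = p.2 i]).
  apply: closed_bigI => i _; apply: closed_bool_eq.
    apply: (@continuous_coord _ (fun=> bool) (f \o fst) i) => p.
    by apply: continuous_comp; [exact: cvg_fst|exact: cf].
  by apply: (@continuous_coord _ (fun=> bool) snd i); exact: snd_continuous.
apply/seteqP; split => p /= H; first by move=> i _ /=; rewrite H.
by apply/funext => i; apply: H.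
Qed.

Lemma continuous_image_suslin (f : baire_space -> cantor_space) :
  continuous f -> suslin (range f).
Proof.
move=> cf; exists [set p | f p.1 = p.2]; split; first exact: closed_graph.
by apply/seteqP; split => x; [move=> [b _ <-]; exists b|move=> [b /= <-]; exists b].
Qed.

Lemma analytic_suslin (A : set cantor_space) : analytic_set A -> suslin A.
Proof.
move=> [->|[f [cf <-]]]; last exact: continuous_image_suslin.
by apply: closed_suslin; exact: closed0.
Qed.

(** Coding the Cantor coordinate by parities pulls [C] back to a closed subset [D] of the Baire
    space. A retraction onto [D], followed by reading off that coordinate, parametrizes the
    projection. *)
Lemma suslin_analytic (A : set cantor_space) : suslin A -> analytic_set A.
Proof.
move=> [C [clC ->]].
pose D : set baire_space := (fun b => (slice 0 b, odds (slice 1 b))) @^-1` C.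
have cD : closed D.
  apply: continuous_closed_preimage clC.
  apply: (@continuous_pair _ _ _ (slice 0) (odds \o slice 1)).
    exact: slice_continuous.
  by apply: continuous_compose; [exact: odds_continuous|exact: slice_continuous].
have [D0|/set0P D0] := eqVneq D set0.
  left; rewrite -subset0 => x [b Cbx]; have [c cx] := odds_surjective x.
  have : D (unslice (fun i => if i is 0%N then b else c)).
    by rewrite /D /= !unsliceK cx.
  by rewrite D0.
have [r [cr rD]] := closed_continuous_image cD D0.
right; exists (odds \o slice 1 \o r); split.
  apply: (continuous_compose _ cr).
  by apply: continuous_compose; [exact: odds_continuous|exact: slice_continuous].
apply/seteqP; split => x.
  move=> [b _ <-]; exists (slice 0 (r b)).
  by have : range r (r b) by []; rewrite rD.
move=> [b Cbx]; have [c cx] := odds_surjective x.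
have : D (unslice (fun i => if i is 0%N then b else c)).
  by rewrite /D /= !unsliceK cx.
by rewrite -rD => -[d _ rd]; exists d => //=; rewrite rd unsliceK.
Qed.

(** A parity code [b] of a point of [U] has some [n] with [agree n b] inside the preimage [V]. For
    fixed [n] such codes form a closed set, so [U] is a countable union of projections. *)
Lemma open_suslin (U : set cantor_space) : open U -> suslin U.
Proof.
move=> oU; pose V := odds @^-1` U.
have oV : open V by move/continuousP: odds_continuous; apply.
rewrite (_ : U = \bigcup_n [set x | exists b, [set b | agree n b `<=` V] b /\ odds b = x]).
  apply: bigcup_suslin => n.
  exists ((fst @^-1` [set b | agree n b `<=` V]) `&` [set p | odds p.1 = p.2]); split => //.
  apply: closedI.
    apply: continuous_closed_preimage; first exact: fst_continuous.
    move=> b /(_ _ (agree_nbhs b n))[c [/= cV bc]] d bd; apply: cV.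
    by apply: agree_trans bd; exact: agree_sym.
  exact: closed_graph odds_continuous.
apply/seteqP; split => x.
  move=> Ux; have [b bx] := odds_surjective x.
  have /nbhs_agree[n nV] : nbhs b V by apply: open_nbhs_nbhs; split => //; rewrite /V /= bx.
  by exists n => //; exists b.
by move=> [n _ [b [/= bV <-]]]; apply: bV.
Qed.

(** The sets that are Suslin together with their complements form a sigma-algebra containing the
    open sets. *)
Lemma borel_bisuslin (B : set cantor_space) : borel_set B -> suslin B /\ suslin (~` B).
Proof.
apply: (@smallest_sub _ _ _ [set B : set cantor_space | suslin B /\ suslin (~` B)]).
  split => /=.
  - by rewrite setC0; split; apply: closed_suslin; [exact: closed0|exact: closedT].
  - by move=> A; rewrite setTD setCK => -[].
  - move=> A H; rewrite setC_bigcup; split.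
      by apply: bigcup_suslin => n; have [] := H n.
    by apply: bigcap_suslin => n; have [] := H n.
move=> U /= oU; split; first exact: open_suslin.
by apply: closed_suslin; rewrite closedC.
Qed.

(** * Borel filters above analytic filters *)

Definition cylinder (s : seq nat) : set baire_space :=
  [set b | forall i, (i < size s)%N -> b i = nth 0%N s i].

Lemma cylinder_mkseq (b : baire_space) n : cylinder (mkseq b n) = [set c | agree n b c].
Proof.
apply/seteqP; split => c /= H i; rewrite ?size_mkseq => ni.
  by rewrite H ?size_mkseq// nth_mkseq.
by rewrite nth_mkseq// H.
Qed.

Lemma cylinder_rcons s : cylinder s = \bigcup_n cylinder (rcons s n).
Proof.
apply/seteqP; split => [b bs|b [n _ bs] i si].
  exists (b (size s)) => // i; rewrite size_rcons ltnS leq_eqVlt nth_rcons => /orP[/eqP->|si].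
    by rewrite ltnn eqxx.
  by rewrite si bs.
by rewrite bs ?size_rcons ?nth_rcons ?si// ltnW.
Qed.

Lemma cylinder_nil : cylinder [::] = setT.
Proof. by apply/seteqP; split. Qed.

Lemma borel_setC (T : topologicalType) (A : set T) : borel_set A -> borel_set (~` A).
Proof. by rewrite -setTD; have [_ + _] := smallest_sigma_algebra setT (@open T); apply. Qed.

Lemma borel_bigcup (T : topologicalType) (A : nat -> set T) :
  (forall n, borel_set (A n)) -> borel_set (\bigcup_n A n).
Proof. by have [_ _ +] := smallest_sigma_algebra setT (@open T); apply. Qed.

Lemma borel_bigcap (T : topologicalType) (A : nat -> set T) :
  (forall n, borel_set (A n)) -> borel_set (\bigcap_n A n).
Proof.
move=> H; rewrite -[X in borel_set X]setCK setC_bigcap; apply: borel_setC.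
by apply: borel_bigcup => n; exact: borel_setC.
Qed.

Lemma borel_open (T : topologicalType) (A : set T) : open A -> borel_set A.
Proof. by move=> oA; exact: sub_sigma_algebra. Qed.

Lemma borel_setI (T : topologicalType) (A B : set T) :
  borel_set A -> borel_set B -> borel_set (A `&` B).
Proof.
move=> bA bB; rewrite -bigcap2E; apply: borel_bigcap => -[|[|n]] //=.
exact: borel_open openT.
Qed.

(* The characteristic functions satisfy [x `&` y `<=` z]; a closed relation. *)
Definition meet_below (x y z : cantor_space) : Prop := forall m, x m -> y m -> z m.

(** Lusin separation for three sets, with the relation [meet_below] taking the place of a common
    point. *)
Definition borel_separated (P Q N : set cantor_space) : Prop :=
  exists B : set cantor_space * set cantor_space * set cantor_space,
    [/\ [/\ borel_set B.1.1, borel_set B.1.2 & borel_set B.2],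
        [/\ P `<=` B.1.1, Q `<=` B.1.2 & N `<=` B.2] &
        forall x y z, B.1.1 x -> B.1.2 y -> B.2 z -> ~ meet_below x y z].

Lemma borel_separated_bigcup (P Q N : nat -> set cantor_space) :
  (forall t : nat * nat * nat, borel_separated (P t.1.1) (Q t.1.2) (N t.2)) ->
  borel_separated (\bigcup_n P n) (\bigcup_n Q n) (\bigcup_n N n).
Proof.
move=> /choice[B HB].
(* A separator for the index [a] has to work against every [b] and [c], hence the intersections
   inside the union; likewise for the other two. *)
exists (\bigcup_a \bigcap_b \bigcap_c (B (a, b, c)).1.1,
        \bigcup_b \bigcap_a \bigcap_c (B (a, b, c)).1.2,
        \bigcup_c \bigcap_a \bigcap_b (B (a, b, c)).2); split => /=.
- split; apply: borel_bigcup => n; apply: borel_bigcap => k; apply: borel_bigcap => l.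
  + by have [[]] := HB (n, k, l).
  + by have [[]] := HB (k, n, l).
  + by have [[]] := HB (k, l, n).
- split => x [n _ xn]; exists n => // b _ c _.
  + by have [_ [+ _ _] _] := HB (n, b, c); apply.
  + by have [_ [_ + _] _] := HB (b, n, c); apply.
  + by have [_ [_ _ +] _] := HB (b, c, n); apply.
- move=> x y z [a _ xa] [b _ yb] [c _ zc].
  have [_ _] := HB (a, b, c); apply.
  + exact: (xa b I c I).
  + exact: (yb a I c I).
  + exact: (zc a I b I).
Qed.

Lemma coord_locally_constant (f : baire_space -> cantor_space) (a : baire_space) (m : nat) :
  continuous f -> exists n, forall b, agree n a b -> f b m = f a m.
Proof.
move=> cf; have /(_ a) cm := @continuous_coord _ (fun=> bool) f m cf.
have /nbhs_agree[n nH] : nbhs a [set b | f b m = f a m].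
  exact: (cm [set k | k = f a m]).
by exists n => b /nH.
Qed.

Lemma open_coord (m : nat) (k : bool) : open [set x : cantor_space | x m = k].
Proof.
have /continuousP := @coord_continuous_prod (fun=> bool) m.
by move=> /(_ [set k]); apply; exact: discrete_open.
Qed.

(* Lusin's argument: were the images not separated, one could keep shrinking the
   three cylinders to single points without ever separating them, yet some
   coordinate separates any three points off the closed relation. *)
Lemma continuous_images_separated (f g h : baire_space -> cantor_space) :
  continuous f -> continuous g -> continuous h ->
  (forall a b c, ~ meet_below (f a) (g b) (h c)) ->
  borel_separated (range f) (range g) (range h).
Proof.
move=> cf cg ch disj; apply: contrapT.
pose bad (s : seq nat * seq nat * seq nat) :=
  ~ borel_separated (f @` cylinder s.1.1) (g @` cylinder s.1.2) (h @` cylinder s.2).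
rewrite -!cylinder_nil => bad0.
pose ext (s : seq nat * seq nat * seq nat) (t : nat * nat * nat) :=
  (rcons s.1.1 t.1.1, rcons s.1.2 t.1.2, rcons s.2 t.2).
have /choice[nxt Hnxt] : forall s, exists t, bad s -> bad (ext s t).
  move=> s; apply: contrapT => /forallNP H.
  have bs : bad s by apply: contrapT => ns; exact: (H (0, 0, 0)%N).
  apply: bs; rewrite (cylinder_rcons s.1.1) (cylinder_rcons s.1.2) (cylinder_rcons s.2).
  rewrite !image_bigcup; apply: borel_separated_bigcup => t.
  by apply: contrapT => bt; apply: (H t).
pose s n := iter n (fun s => ext s (nxt s)) ([::], [::], [::]).
have bads n : bad (s n) by elim: n => //= n; exact: Hnxt.
pose a : baire_space := fun n => (nxt (s n)).1.1.
pose b : baire_space := fun n => (nxt (s n)).1.2.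
pose c : baire_space := fun n => (nxt (s n)).2.
have sE n : s n = (mkseq a n, mkseq b n, mkseq c n).
  elim: n => [//|n IH].
  have ea : (s n).1.1 = mkseq a n by rewrite IH.
  have eb : (s n).1.2 = mkseq b n by rewrite IH.
  have ec : (s n).2 = mkseq c n by rewrite IH.
  by rewrite !mkseqS -ea -eb -ec.
have /existsNP[m /not_implyP[am /not_implyP[bm cm]]] := disj a b c.
have [na Ha] := coord_locally_constant a m cf.
have [nb Hb] := coord_locally_constant b m cg.
have [nc Hc] := coord_locally_constant c m ch.
pose n := maxn na (maxn nb nc).
apply: (bads n); rewrite sE !cylinder_mkseq /=.
exists ([set x : cantor_space | x m = true], [set x : cantor_space | x m = true],
        [set x : cantor_space | x m = false]).
split => /=; first by split; apply: borel_open; exact: open_coord.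
  split => _ [d dn <-] /=.
  - by rewrite Ha //; apply: agree_le dn; rewrite leq_max leqnn.
  - by rewrite Hb //; apply: agree_le dn; rewrite !leq_max leqnn orbT.
  - by rewrite Hc; [exact/negP|apply: agree_le dn; rewrite !leq_max leqnn !orbT].
by move=> x y z xm ym zm /(_ m); rewrite xm ym zm => /(_ isT isT).
Qed.

(** If [x] and [y] lie in [F] and [meet_below x y z], then [z] lies in [F], hence in [B]. So two
    copies of [F] and the complement of [B], which is analytic too, admit no related triple; the
    separators of the two copies are intersected. *)
Lemma borel_shrink (F : set_system nat) (B : set cantor_space) :
  filter_on_nat F -> analytic_filter F -> borel_set B -> in_cantor F `<=` B ->
  exists B', [/\ borel_set B', in_cantor F `<=` B' &
    forall x y z, B' x -> B' y -> meet_below x y z -> B z].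
Proof.
move=> [FP _] anF bB FB; have [NB0|[h [ch hN]]] := suslin_analytic (borel_bisuslin bB).2.
  exists setT; split => //; first exact: borel_open openT.
  by move=> x y z _ _ _; apply: contrapT => nz; have : (~` B) z by []; rewrite NB0.
have [F0|[f [cf fF]]] := anF.
  have : in_cantor F (fun=> true) by apply: (@filterS _ F _ setT) => //; exact: filterT.
  by rewrite F0.
have [|B1 [[b1 b2 b3] [s1 s2 s3] sep]] := continuous_images_separated cf cf ch.
  move=> a b c H.
  have Fa : F [set n | f a n] by have : range f (f a) by []; rewrite fF.
  have Fb : F [set n | f b n] by have : range f (f b) by []; rewrite fF.
  have : range h (h c) by [].
  rewrite hN; apply; apply: FB; apply: filterS (filterI Fa Fb) => m [/= am bm].
  exact: H.
rewrite fF in s1 s2; rewrite hN in s3.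
exists (B1.1.1 `&` B1.1.2); split; first exact: borel_setI.
  by move=> x Fx; split; [exact: s1|exact: s2].
by move=> x y z [x1 _] [_ y2] H; apply: contrapT => /s3 z3; exact: (sep x y z).
Qed.

Lemma analytic_filter_sub_borel (F : set_system nat) :
  filter_on_nat F -> analytic_filter F ->
  exists G : set_system nat, [/\ filter_on_nat G, borel_filter G & F `<=` G].
Proof.
move=> FF anF; have [FP cofF] := FF.
have /choice[sh Hsh] : forall B, exists B', borel_set B /\ in_cantor F `<=` B ->
    [/\ borel_set B', in_cantor F `<=` B' &
    forall x y z, B' x -> B' y -> meet_below x y z -> B z].
  move=> B; have [[bB FB]|nB] := pselect (borel_set B /\ in_cantor F `<=` B).
    by have [B' HB'] := borel_shrink FF anF bB FB; exists B'.
  by exists setT.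
(* Starting from the nonempty sets makes the limit filter proper. *)
pose B n := iter n sh (\bigcup_n [set x : cantor_space | x n = true]).
have HB n : borel_set (B n) /\ in_cantor F `<=` B n.
  elim: n => [|n IH]; last by have [] := Hsh _ IH.
  split; first by apply: borel_bigcup => n; apply: borel_open; exact: open_coord.
  by move=> x /filter_ex[n xn]; exists n.
have Bmeet n x y z : B n.+1 x -> B n.+1 y -> meet_below x y z -> B n z.
  by have [_ _] := Hsh _ (HB n); apply.
pose char (A : set nat) : cantor_space := fun n => `[< A n >].
(* Stage [n.+1] yields the filter axioms only at stage [n]; they close up on the intersection of all
   stages. *)
pose G : set_system nat := [set A | forall n, B n (char A)].
have FG : F `<=` G.
  move=> A FA n; apply: (HB n).2; apply: filterS FA => m Am.
  exact/asboolP.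
exists G; split => //.
- split; last by move=> A fA; apply: FG; exact: cofF.
  split; first by move=> /(_ 0%N)[n _ /= /asboolP].
  split.
  + by apply: FG; exact: filterT.
  + move=> P Q GP GQ n; apply: (Bmeet n (char P) (char Q)) => // m /asboolP Pm /asboolP Qm.
    exact/asboolP.
  (* Upward closure is the meet property applied to [P] twice. *)
  + move=> P Q PQ GP n; apply: (Bmeet n (char P) (char P)) => // m /asboolP Pm _.
    exact/asboolP/PQ.
- rewrite /borel_filter (_ : in_cantor G = \bigcap_n B n).
    by apply: borel_bigcap => n; have [] := HB n.
  have charE (x : cantor_space) : char [set n | x n] = x.
    by apply/funext => n; apply/asboolP/idP.
  apply/seteqP; split => x H n; first by move=> _; have := H n; rewrite charE.
  by rewrite charE; exact: H.
Qed.

(** * Baire category *)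

Lemma exists_invS_lt (R : realType) (e : R) : 0 < e -> exists j : nat, j.+1%:R^-1 < e.
Proof. by move=> /ltr_add_invr[j]; rewrite add0r; exists j. Qed.

(** Phrased with dense open sets rather than nowhere dense ones, to match the Baire category
    theorem. *)
Definition meager (X : topologicalType) (A : set X) : Prop :=
  exists G : nat -> set X,
    (forall n, open (G n) /\ dense (G n)) /\ \bigcap_n G n `<=` ~` A.

Lemma sub_meager (X : topologicalType) (A B : set X) : A `<=` B -> meager B -> meager A.
Proof. by move=> AB [G [oG GB]]; exists G; split => // x /GB nB /AB. Qed.

Lemma setC_open_dense_meager (X : topologicalType) (U : set X) :
  open U -> dense U -> meager (~` U).
Proof. by move=> oU dU; exists (fun=> U); split => // x /(_ 0%N I) Ux; apply. Qed.

Lemma dense_setT (X : topologicalType) : dense [set: X].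
Proof. by move=> O O0 _; rewrite setIT. Qed.

Lemma meager_bigcup (X : topologicalType) (J : countType) (A : J -> set X) :
  (forall i, meager (A i)) -> meager (\bigcup_i A i).
Proof.
move=> /choice[G HG].
exists (fun k => if unpickle k is Some (i, n) then G i n else setT); split.
  move=> k; case: (unpickle k) => [[i n]|]; first exact: (HG i).1.
  by split; [exact: openT|exact: dense_setT].
move=> x Gx [i _]; apply: (HG i).2 => n _.
by have := Gx (pickle (i, n)) I; rewrite pickleK.
Qed.

Lemma meagerU (X : topologicalType) (A B : set X) :
  meager A -> meager B -> meager (A `|` B).
Proof.
move=> mA mB; apply: (@sub_meager _ _ (\bigcup_(b : bool) if b then A else B)).
  by move=> x [Ax|Bx]; [exists true|exists false].
by apply: meager_bigcup => -[].
Qed.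

(** Adding to [N] the exterior of its closure gives a dense open set, whose complement is the
    boundary. *)
Lemma boundary_meager (X : topologicalType) (N : set X) :
  open N -> meager (closure N `\` N).
Proof.
move=> oN; rewrite setDE -[closure N]setCK -setCU; apply: setC_open_dense_meager.
  by apply: openU => //; rewrite openC; exact: closed_closure.
move=> O [x Ox] oO; have [nx|cx] := pselect ((~` closure N) x).
  by exists x; split => //; left.
have {}cx := contrapT cx.
have [y [Ny Oy]] : N `&` O !=set0 by apply: cx; exact: open_nbhs_nbhs.
by exists y; split => //; right.
Qed.

(** * Category of projections of closed sets *)

Section category.
Variables (R : realType) (X : completeNormedModType R) (d : nat -> X).
Hypothesis denseX : forall (x : X) (e : R), 0 < e -> exists i, `|x - d i| < e.

Lemma open_not_meager (U : set X) : open U -> U !=set0 -> ~ meager U.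
Proof.
move=> oU U0 [G [oG GU]]; have [x [Ux Gx]] := Baire oG U0 oU.
exact: GU Gx Ux.
Qed.

Let basic (k : nat * nat) : set X := ball (d k.1) (k.2.+1%:R^-1 : R).

Let basic_open k : open (basic k).
Proof. exact: ball_open. Qed.

Let basicP (V : set X) (x : X) : open V -> V x -> exists k, basic k x /\ basic k `<=` V.
Proof.
move=> oV Vx; have /nbhs_ballP[e /= e0 eV] : nbhs x V by exact: open_nbhs_nbhs.
have [j je] := exists_invS_lt (divr_gt0 e0 (ltr0n R 2)).
have j0 : 0 < j.+1%:R^-1 :> R by rewrite invr_gt0 ltr0n.
have [i xi] := denseX x j0.
exists (i, j); split; first by rewrite /basic /= -ball_normE /= distrC.
move=> y; rewrite /basic /= -ball_normE /= => yi.
apply: eV; rewrite -ball_normE /=.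
rewrite (splitr e) (_ : x - y = (x - d i) + (d i - y)); last by rewrite addrA subrK.
by apply: le_lt_trans (ler_normD _ _) _; rewrite ltrD// (lt_trans _ je).
Qed.

Variable C : set (baire_space * X).
Hypothesis clC : closed C.

(** The Suslin scheme of the projection, which is [A [::]]. *)
Let A (s : seq nat) : set X := [set x | exists2 b, cylinder s b & C (b, x)].

(** The base being countable, [A s] is still meager in this union of basic balls. *)
Let N (s : seq nat) : set X := \bigcup_(k in [set k | meager (basic k `&` A s)]) basic k.

(** In no nonempty open subset of [U s] is [A s] meager. *)
Let U (s : seq nat) : set X := ~` closure (N s).

Let open_N s : open (N s).
Proof. by apply: bigcup_open => k _; exact: basic_open. Qed.

Let open_U s : open (U s).
Proof. by rewrite openC; exact: closed_closure. Qed.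

Let meager_AN s : meager (A s `&` N s).
Proof.
apply: (@sub_meager _ _ (\bigcup_k (if pselect (meager (basic k `&` A s)) then
  basic k `&` A s else set0))).
  by move=> x [Ax [k mk kx]]; exists k => //; case: pselect.
apply: meager_bigcup => k; case: pselect => [//|nm].
exists (fun=> setT); split => [n|x _ //].
by split; [exact: openT|exact: dense_setT].
Qed.

Let meager_AclN s : meager (A s `&` closure (N s)).
Proof.
apply: sub_meager (meagerU (meager_AN s) (boundary_meager (@open_N s))) => x [Ax cx].
by have [Nx|nNx] := pselect (N s x); [left|right].
Qed.

Let A_rcons s : A s = \bigcup_n A (rcons s n).
Proof.
apply/seteqP; split => x.
  by move=> [b bs Cb]; move: bs; rewrite cylinder_rcons => -[n _ bn]; exists n => //; exists b.
by move=> [n _ [b bn Cb]]; exists b => //; rewrite cylinder_rcons; exists n.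
Qed.

(** A point of [U s] that lies in [G s] belongs to some [U (rcons s n)]; this lets a branch be
    continued. *)
Let G (s : seq nat) : set X := (\bigcup_n U (rcons s n)) `|` ~` closure (U s).

Let open_G s : open (G s).
Proof.
apply: openU; first by apply: bigcup_open => n _; exact: open_U.
by rewrite openC; exact: closed_closure.
Qed.

(** If an open [V] meets [U s] but misses [G s], every [A (rcons s n)] is meager in the part of [V]
    inside [U s]. So is their union [A s], which contradicts the choice of [U s]. *)
Let dense_G s : dense (G s).
Proof.
move=> V [x Vx] oV; have [ncx|cx] := pselect ((~` closure (U s)) x).
  by exists x; split => //; right.
have {}cx := contrapT cx.
have [y [Uy Vy]] : U s `&` V !=set0 by apply: cx; exact: open_nbhs_nbhs.
apply: contrapT => nGV.
have VU n : V `&` U s `<=` closure (N (rcons s n)).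
  move=> z [Vz Uz]; apply: contrapT => nz; apply: nGV.
  by exists z; split => //; left; exists n.
have : meager ((V `&` U s) `&` A s).
  rewrite A_rcons setI_bigcupr; apply: meager_bigcup => n.
  by apply: sub_meager (meager_AclN (rcons s n)) => z [/VU].
have [k [ky kV]] := basicP (openI oV (open_U s)) (conj Vy Uy).
move=> mVA; have Ny : N s y.
  by exists k => //; apply: sub_meager mVA => z [/kV].
exact: Uy (subset_closure Ny).
Qed.

Let U_near s x : U s x -> closure (A s) x.
Proof.
move=> Ux V; rewrite nbhsE => -[W [oW Wx] WV].
apply: contrapT => nAV; apply: Ux; apply: subset_closure.
have [k [kx kW]] := basicP oW Wx; exists k => //=.
apply: (@sub_meager _ _ (~` setT)); last first.
  by apply: setC_open_dense_meager; [exact: openT|exact: dense_setT].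
by move=> z [/kW Wz Az]; exfalso; apply: nAV; exists z; split => //; exact: WV.
Qed.

(* Analytic sets have the Baire property; only this consequence is needed. *)
Lemma nonmeager_projection_comeager :
  ~ meager [set x | exists b, C (b, x)] ->
  exists V : set X, [/\ open V, V !=set0 &
    meager (V `\` [set x | exists b, C (b, x)])].
Proof.
move=> nmA; exists (U [::]); split; first exact: open_U.
  apply: contrapT => U0; apply: nmA.
  apply: sub_meager (meager_AclN [::]) => x [b Cb]; split.
    by exists b => //; rewrite cylinder_nil.
  by apply: contrapT => nc; apply: U0; exists x.
apply: (@sub_meager _ _ (\bigcup_s ~` G s)); last first.
  by apply: meager_bigcup => s; apply: setC_open_dense_meager; [exact: open_G|exact: dense_G].
move=> x [Ux nAx]; apply: contrapT => nG; apply: nAx.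
(* Since [x] lies in every [G s], one can descend forever from [U [::]]; the branch [a] so obtained
   will be the witness for [x]. *)
have /choice[nxt Hnxt] : forall s, exists n, U s x -> U (rcons s n) x.
  move=> s; have [Us|nU] := pselect (U s x); last by exists 0%N.
  have : G s x by apply: contrapT => ns; apply: nG; exists s.
  by move=> [[n _ Un]|/(_ (subset_closure Us))//]; exists n.
pose s n := iter n (fun s => rcons s (nxt s)) [::].
have Us n : U (s n) x by elim: n => //= n; exact: Hnxt.
pose a : baire_space := fun n => nxt (s n).
have sE n : s n = mkseq a n by elim: n => [//|n IH]; rewrite mkseqS -IH.
(* Each [U (s n)] lies in the closure of [A (s n)], so points of [C] accumulate at the pair of [a]
   and [x]. *)
exists a; apply: clC => V [[P Q] /= [Pa Qx]] PQV.
have [n nP] := nbhs_agree Pa.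
have [y [[b bn Cby] Qy]] := U_near (Us n) Qx.
exists (b, y); split => //; apply: PQV; split => //=; apply: nP.
by move: bn; rewrite sE cylinder_mkseq.
Qed.

End category.

(** * Separable Banach spaces as images of the Baire space *)

Section separable_parametrization.
Variables (R : realType) (V : completeNormedModType R) (d : nat -> V).
Hypothesis denseV : forall (x : V) (e : R), 0 < e -> exists i, `|x - d i| < e.

Let p (n : nat) : R := 2^-1 ^+ n.

Let pS n : p n = 2 * p n.+1.
Proof. by rewrite /p exprS mulrA divff ?mul1r// pnatr_eq0. Qed.

Let p_gt0 n : 0 < p n.
Proof. by rewrite exprn_gt0// invr_gt0. Qed.

Let p_small (e : R) : 0 < e -> exists n, p n < e.
Proof.
move=> e0; have [n _ nH] := near_infty_natSinv_expn_lt (PosNum e0).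
by exists n; have := nH n (leqnn n); rewrite /= /p exprVn div1r.
Qed.

(* Far-away terms of [d \o b] are skipped, which forces convergence for every [b]. *)
Let u (b : baire_space) : nat -> V :=
  fix u n := if n is n'.+1 then
    (if `|d (b n) - u n'| < p n' then d (b n) else u n') else d (b 0%N).

Let u_step b n : `|u b n.+1 - u b n| <= p n.
Proof.
rewrite /=; case: ifPn => [/ltW//|_].
by rewrite subrr normr0 ltW.
Qed.

(** The right-hand side is the geometric sum of [p i] over [n <= i < n + k]. *)
Let u_tail b n k : `|u b (n + k)%N - u b n| <= 2 * (p n - p (n + k)%N).
Proof.
elim: k => [|k IH]; first by rewrite addn0 !subrr normr0 mulr0.
apply: le_trans (ler_distD (u b (n + k)%N) _ _) _; rewrite addnS.
by have := u_step b (n + k)%N; have := pS (n + k)%N; lra.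
Qed.

Let u_cvg b : exists l : V, u b @ \oo --> l.
Proof.
apply/cvg_ex; apply: cauchy_cvg; apply: cauchy_exP => e /= e0.
have [n ne] := p_small (divr_gt0 e0 (ltr0n R 2)).
exists (u b n); exists n => // m /= nm; rewrite -ball_normE /= distrC.
have := u_tail b n (m - n); rewrite subnKC//.
by have := p_gt0 m; lra.
Qed.

Let g (b : baire_space) : V := lim (u b @ \oo).

Let g_cvg b : u b @ \oo --> g b.
Proof. by have [l ul] := u_cvg b; apply/cvg_ex; exists l. Qed.

Let g_near b n : `|g b - u b n| <= 2 * p n.
Proof.
apply/ler_addgt0Pr => e e0.
have /cvgrPdist_lt/(_ e e0)[N _ HN] := @g_cvg b.
have := HN (n + N)%N (leq_addl _ _) => /= gN.
apply: le_trans (ler_distD (u b (n + N)%N) _ _) _.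
by have := u_tail b n N; have := p_gt0 (n + N)%N; lra.
Qed.

Let u_agree n b c : agree n.+1 b c -> u c n = u b n.
Proof.
elim: n => [|n IH] bc /=; first by rewrite bc.
by rewrite IH ?bc//; exact: agree_le bc.
Qed.

Let g_continuous : continuous g.
Proof.
move=> b; apply/cvgrPdist_lt => e e0.
have [n ne] := p_small (divr_gt0 e0 (ltr0n R 4)).
apply: filterS (agree_nbhs b n.+1) => c /u_agree cb.
apply: le_lt_trans (ler_distD (u b n) _ _) _.
have := g_near b n; have := g_near c n; rewrite cb [`|g c - _|]distrC.
by lra.
Qed.

Let g_surjective x : exists b, g b = x.
Proof.
(* With precision [p n.+2], consecutive terms differ by less than [p n], so none is skipped. *)
have /choice[b bx] : forall n, exists i, `|x - d i| < p n.+2.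
  by move=> n; exact: denseV.
have ub n : u b n = d (b n).
  elim: n => //= n ->; rewrite ifT//.
  apply: le_lt_trans (ler_distD x _ _) _; rewrite [`|_ - x|]distrC.
  have := bx n; have := bx n.+1; have := pS n; have := pS n.+1; have := pS n.+2.
  by have := p_gt0 n.+3; lra.
exists b; apply/eqP; rewrite -subr_eq0 -normr_le0; apply/ler_addgt0Pr => e e0.
have [n ne] := p_small (divr_gt0 e0 (ltr0n R 3)).
apply: le_trans (ler_distD (u b n) _ _) _.
have := g_near b n; have := bx n; rewrite ub [`|d _ - _|]distrC.
by have := pS n; have := pS n.+1; have := p_gt0 n.+2; lra.
Qed.

Lemma separable_continuous_image : exists h : baire_space -> V,
  continuous h /\ forall x, exists b, h b = x.
Proof. by exists g; split; [exact: g_continuous|exact: g_surjective]. Qed.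

End separable_parametrization.

Lemma ratr_near (R : realType) (x e : R) : 0 < e -> exists q : rat, `|x - ratr q| < e.
Proof.
move=> e0; have /rat_in_itvoo[q] : x < x + e by rewrite ltrDl.
rewrite in_itv/= => /andP[xq qe]; exists q.
by rewrite distrC gtr0_norm ?subr_gt0//; lra.
Qed.

Lemma real_dense_sequence (R : realType) :
  exists d : nat -> R, forall (x : R) (e : R), 0 < e -> exists i, `|x - d i| < e.
Proof.
exists (fun k => if unpickle k is Some q then ratr q else 0) => x e /(ratr_near x)[q xq].
by exists (pickle q); rewrite pickleK.
Qed.

Lemma span_dense_sequence (R : realType) (X : completeNormedModType R) (e : nat -> X) :
  (forall (x : X) (eps : R), 0 < eps -> exists a m, `|x - partial_sum e a m| < eps) ->
  exists d : nat -> X, forall (x : X) (eps : R), 0 < eps -> exists i, `|x - d i| < eps.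
Proof.
move=> H; exists (fun k => if unpickle k is Some l then
  \sum_(i < size l) ratr (nth (0 : rat) l i) *: e i else 0) => x eps eps0.
have [a [m xam]] := H x (eps / 2) (divr_gt0 eps0 (ltr0n R 2)).
(* The summand 1 keeps [M] positive; rounding each coefficient to within [dl] then moves the sum by
   at most [eps / 2]. *)
pose M := \sum_(i < m.+1) `|e i| + 1.
have S0 : 0 <= \sum_(i < m.+1) `|e i| by apply: sumr_ge0.
have M0 : 0 < M by rewrite /M; lra.
pose dl := eps / 2 / M.
have dl0 : 0 < dl by rewrite !divr_gt0.
have /choice[q aq] : forall i, exists q : rat, `|a i - ratr q| < dl.
  by move=> i; exact: ratr_near.
exists (pickle (mkseq q m.+1)); rewrite pickleK size_mkseq.
apply: le_lt_trans (ler_distD (partial_sum e a m) _ _) _.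
suff : `|partial_sum e a m - \sum_(i < m.+1) ratr (nth (0 : rat) (mkseq q m.+1) i) *: e i|
    <= eps / 2.
  by move=> ?; lra.
rewrite /partial_sum -sumrB; apply: le_trans (ler_norm_sum _ _ _) _.
apply: (@le_trans _ _ (\sum_(i < m.+1) dl * `|e i|)).
  apply: ler_sum => i _; rewrite nth_mkseq// -scalerBl normrZ.
  by apply: ler_wpM2r => //; exact: ltW.
rewrite -mulr_sumr /dl mulrAC ler_pdivrMr// ler_pM2l ?divr_gt0//.
by rewrite /M lerDl.
Qed.

(** * Filter basis systems *)

Lemma finite_nat_bounded (A : set nat) : finite_set A -> exists k, forall n, A n -> (n < k)%N.
Proof.
move=> /finite_seqP[s ->]; exists (\max_(i <- s) i).+1 => n /= ns.
by rewrite ltnS; exact: (leq_bigmax_seq (F := id)).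
Qed.

Lemma filter_on_nat_ge (F : set_system nat) (k : nat) :
  filter_on_nat F -> F [set m | (k <= m)%N].
Proof.
move=> [_ cofF]; apply: cofF; apply: sub_finite_set (finite_II k) => m /= /negP.
by rewrite -ltnNge.
Qed.

(** * Closed sets, continuity and translations in normed spaces *)

Lemma closed_le_const (S : topologicalType) (R : realType) (u : S -> R) (c : R) :
  continuous u -> closed [set s | u s <= c].
Proof.
by move=> cu;
  apply: (@continuous_closed_preimage _ _ u [set x | x <= c]) => //; exact: closed_le.
Qed.

Lemma closed_ge_const (S : topologicalType) (R : realType) (u : S -> R) (c : R) :
  continuous u -> closed [set s | c <= u s].
Proof.
by move=> cu;
  apply: (@continuous_closed_preimage _ _ u [set x | c <= x]) => //; exact: closed_ge.
Qed.

Lemma closed_eq_const (S : topologicalType) (R : realType) (u : S -> R) (c : R) :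
  continuous u -> closed [set s | u s = c].
Proof.
by move=> cu; apply: (@continuous_closed_preimage _ _ u [set x | x = c]) => //; exact: closed_eq.
Qed.

Lemma continuous_norm (S : topologicalType) (R : realType) (X : normedModType R) (u : S -> X) :
  continuous u -> continuous (fun s => `|u s| : R).
Proof. by move=> cu s; apply: cvg_norm; exact: cu. Qed.

Lemma continuous_sub (S : topologicalType) (R : realType) (X : normedModType R) (u v : S -> X) :
  continuous u -> continuous v -> continuous (fun s => u s - v s).
Proof. by move=> cu cv s; apply: continuousB; [exact: cu|exact: cv]. Qed.

Lemma continuous_partial_sum (S : topologicalType) (R : realType)
    (X : completeNormedModType R) (e : nat -> X) (a : nat -> S -> R) (m : nat) :
  (forall n, continuous (a n)) -> continuous (fun s => partial_sum e (a ^~ s) m).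
Proof.
move=> ca; rewrite /partial_sum.
elim: (m.+1) => [|n IH].
  under [fun _ => _]funext do rewrite big_ord0.
  exact: cst_continuous.
rewrite (_ : (fun _ => _) = (fun s => \sum_(i < n) a i s *: e i) \+ (fun s => a n s *: e n)).
  move=> s; apply: continuousD; first exact: IH.
  by apply: continuousZr_tmp; exact: ca.
by apply/funext => s; rewrite big_ord_recr.
Qed.

Lemma scalar_bounded_continuous (R : realType) (X : normedModType R)
    (f : {scalar X}) (r N : R) :
  0 < r -> 0 <= N -> (forall h, `|h| < r -> `|f h| <= N) -> continuous (f : X -> R).
Proof.
move=> r0 N0 H x; apply/cvgrPdist_lt => eps eps0.
have N1 : 0 < N + 1 by lra.
(* Stretching by [c] turns the bound [N] into [N / c], and the added 1 makes this strictly less than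
   [eps]. *)
pose c := (N + 1) / eps.
have c0 : 0 < c by rewrite divr_gt0.
apply/nbhs_ballP; exists (r / c); first exact: divr_gt0.
move=> y; rewrite -ball_normE /= => xy.
have : `|f (c *: (x - y))| <= N.
  by apply: H; rewrite normrZ gtr0_norm// mulrC -ltr_pdivlMr.
rewrite linearZ /= normrM gtr0_norm// linearB /= /c => le.
rewrite -(ltr_pM2l c0) /c; apply: le_lt_trans le _.
by rewrite divfK ?gt_eqF//; lra.
Qed.

Lemma continuous_add_const (R : realType) (X : normedModType R) (h : X) :
  continuous (fun x => x + h).
Proof. by move=> x; apply: continuousD; [exact: cvg_id|exact: cst_continuous]. Qed.

Lemma meager_translate (R : realType) (X : normedModType R) (A : set X) (h : X) :
  meager A -> meager ((fun x => x + h) @^-1` A).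
Proof.
move=> [G [oG GA]]; exists (fun n => (fun x => x + h) @^-1` G n); split; last first.
  by move=> x Gx; apply: GA => n _; exact: Gx.
move=> n; have [oGn dGn] := oG n; split.
  by have /continuousP := @continuous_add_const R X h; apply.
move=> O [x Ox] oO.
have [||y [Oy Gy]] := dGn ((fun x => x - h) @^-1` O).
- by exists (x + h); rewrite /= addrK.
- by have /continuousP := @continuous_add_const R X (- h); apply.
- by exists (y - h); rewrite /= subrK.
Qed.

Lemma partial_sumZ (R : realType) (X : completeNormedModType R) (e : nat -> X)
    (c : R) (a : nat -> R) (m : nat) :
  partial_sum e (fun n => c * a n) m = c *: partial_sum e a m.
Proof.
by rewrite /partial_sum scaler_sumr; apply: eq_bigr => i _; rewrite scalerA.
Qed.

Lemma biorthogonal_partial_sum (R : realType) (X : completeNormedModType R)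
    (e : nat -> X) (esharp : nat -> {scalar X}) (a : nat -> R) (k m : nat) :
  biorthogonal e esharp -> (k <= m)%N -> esharp k (partial_sum e a m) = a k.
Proof.
move=> bi; rewrite -ltnS => km; rewrite /partial_sum linear_sum.
rewrite (bigD1 (Ordinal km)) //= linearZ /= bi eqxx mulr1 big1 ?addr0// => i ik.
rewrite linearZ /= bi (_ : (k == i :> nat) = false) ?mulr0//.
by apply/negbTE; rewrite eq_sym.
Qed.

(** * Continuity, minimality and compatible filters *)

Section filter_basis_system.
Variables (R : realType) (X : completeNormedModType R).
Variables (e : nat -> X) (esharp : nat -> {scalar X}).
Hypothesis bi : biorthogonal e esharp.

Notation expansion x := (partial_sum e (fun n => esharp n x)).

Lemma compatible_cvg (F : set_system nat) (x : X) :
  compatible e esharp F -> expansion x @ F --> x.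
Proof.
move=> [_ /(_ x)[a [ax _]] H].
by rewrite (_ : (fun n => esharp n x) = a)//; apply/funext => n; exact: H.
Qed.

Lemma compatible_near (F : set_system nat) (x : X) (eps : R) :
  compatible e esharp F -> 0 < eps -> F [set m | `|x - expansion x m| < eps].
Proof.
move=> cF e0; have [[FP _] _ _] := cF.
by have /cvgrPdist_lt/(_ eps e0) := compatible_cvg (x := x) cF.
Qed.

(** From index [k] on, the [k]-th functional takes the value [a k] on the partial sums, and its
    level sets are closed. This gives uniqueness of coefficients along filters not yet known to be
    compatible. *)
Lemma continuous_coordinate_limit (F : set_system nat) :
  filter_on_nat F -> (forall n, continuous (esharp n : X -> R)) ->
  forall (x : X) (a : nat -> R), partial_sum e a @ F --> x -> forall k, esharp k x = a k.
Proof.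
move=> FF ce x a ax k; have [FP _] := FF.
apply: (closed_cvg (fun y => esharp k y = a k)) ax.
  exact: (closed_eq_const (ce k)).
apply: filterS (filter_on_nat_ge k FF) => m /= km.
exact: biorthogonal_partial_sum.
Qed.

(** The kernel of [esharp k] is closed and contains every [e n] with [n <> k], but not [e k]. *)
Lemma continuous_minimal :
  (forall n, continuous (esharp n : X -> R)) -> minimal_sequence e.
Proof.
move=> ce k ck.
have cl0 : closed [set y | esharp k y = 0].
  exact: (closed_eq_const (ce k)).
have : closure [set y | esharp k y = 0] (e k).
  apply: closure_subset ck => _ [n [c [v [vA ->]]]] /=.
  rewrite linear_sum big1// => i _; rewrite linearZ /=.
  have [j jk <-] := vA i; rewrite bi (_ : (k == j) = false) ?mulr0//.
  by apply/negbTE/eqP => kj; apply: jk.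
rewrite -(iffLR (closure_id _) cl0) /= bi eqxx => /eqP.
by rewrite oner_eq0.
Qed.

(** A positive distance [r] from [e k] to the span of the other vectors bounds the [k]-th
    coefficient of every partial sum by its norm over [r]; the bound passes to the limit along
    [F]. *)
Lemma minimal_continuous (F : set_system nat) : compatible e esharp F ->
  minimal_sequence e -> forall n, continuous (esharp n : X -> R).
Proof.
move=> cF me k; have [FF _ _] := cF; have [FP _] := FF.
have [r r0 Hr] : exists2 r : R, 0 < r & forall y,
    linear_span [set e n | n in [set n | n <> k]] y -> r <= `|e k - y|.
  have /existsNP[B /not_implyP[/nbhs_ballP[r /= r0 rB] nB]] := me k.
  exists r => // y sy; rewrite leNgt; apply/negP => ry; apply: nB.
  by exists y; split => //; apply: rB; rewrite -ball_normE.
have Hsum (a : nat -> R) m : (k <= m)%N -> `|a k| * r <= `|partial_sum e a m|.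
  rewrite -ltnS => km; have [->|ak] := eqVneq (a k) 0; first by rewrite normr0 mul0r.
  (* Factoring out [a k] leaves [e k] minus a combination of the others. Slot [k] gets coefficient 0
     and the dummy vector [e k.+1], so that every [v i] avoids [e k]. *)
  pose c (i : 'I_m.+1) := if i == k :> nat then 0 else - (a i / a k).
  pose v (i : 'I_m.+1) := e (if i == k :> nat then k.+1 else i).
  have -> : partial_sum e a m = a k *: (e k - \sum_i c i *: v i).
    rewrite /partial_sum (bigD1 (Ordinal km)) //= scalerBr; congr (_ + _).
    rewrite [in RHS](bigD1 (Ordinal km)) //= {1}/c eqxx scale0r add0r scaler_sumr -sumrN.
    apply: eq_bigr => i ik; have {}ik : (i == k :> nat) = false by apply/negbTE.
    by rewrite /c /v ik scaleNr scalerN opprK scalerA mulrC divfK.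
  rewrite normrZ ler_wpM2l//; apply: Hr; exists m.+1, c, v; split => // i.
  rewrite /v; case: ifPn => [_|/eqP ik]; last by exists i.
  by exists k.+1 => //= /eqP; rewrite (gtn_eqF (ltnSn k)).
apply: (@scalar_bounded_continuous _ _ _ r 1) => // h hr.
suff : `|esharp k h| * r <= `|h|.
  by rewrite -ler_pdivlMr// => /le_trans; apply; rewrite ler_pdivrMr// mul1r ltW.
apply/ler_addgt0Pr => eps eps0.
have [m [/= km hm]] := filter_ex (filterI (filter_on_nat_ge k FF) (compatible_near h cF eps0)).
apply: le_trans (Hsum (fun n => esharp n h) m km) _.
have := ler_distD 0 (expansion h m) h; rewrite subr0 sub0r normrN.
have := ler_distD h (expansion h m) 0; rewrite !subr0 [`|_ - h|]distrC.
by lra.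
Qed.

(* Rescaling [x] reduces every radius to 1. *)
Definition expansion_filter : set_system nat :=
  [set A | exists (l : seq X) (k : nat), forall m, (k <= m)%N ->
     (forall x, x \in l -> `|x - expansion x m| < 1) -> A m].

Lemma expansion_filter_sub (F : set_system nat) :
  compatible e esharp F -> expansion_filter `<=` F.
Proof.
move=> cF A [l [k H]]; have [FF _ _] := cF; have [FP _] := FF.
have : F [set m | forall x, x \in l -> `|x - expansion x m| < 1].
  elim: l {H} => [|y l IH]; first by apply: filterS (filter_on_nat_ge 0 FF) => m _ x.
  apply: filterS (filterI (compatible_near y cF ltr01) IH) => m [/= ym lm] x.
  by rewrite in_cons => /orP[/eqP->//|]; exact: lm.
by move=> Fl; apply: filterS (filterI (filter_on_nat_ge k FF) Fl) => m [/= km]; exact: H.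
Qed.

(** Convergence along this filter implies convergence along the larger [F], so uniqueness of
    coefficients is inherited; the expansions converge by construction. *)
Lemma expansion_filter_compatible (F : set_system nat) :
  compatible e esharp F -> compatible e esharp expansion_filter.
Proof.
move=> cF; have subF := expansion_filter_sub cF; have [[FP _] _ coordF] := cF.
have EP : ProperFilter expansion_filter.
  split; first by move=> /subF; exact: filter_not_empty.
  split.
  - by exists [::], 0%N.
  - move=> A B [l [k Hl]] [l' [k' Hl']]; exists (l ++ l'), (maxn k k') => m.
    rewrite geq_max => /andP[km k'm] H; split; [apply: Hl|apply: Hl'] => // x xl;
      by apply: H; rewrite mem_cat xl ?orbT.
  - by move=> A B AB [l [k Hl]]; exists l, k => m km H; apply: AB; exact: Hl.
have uniq x a : partial_sum e a @ expansion_filter --> x -> forall k, esharp k x = a k.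
  by move=> ax; apply: coordF => U /ax /subF.
split => //.
  split => // A /finite_nat_bounded[k Hk]; exists [::], k => m km _.
  by apply: contrapT => /Hk; rewrite ltnNge km.
move=> x; exists (fun n => esharp n x); split; last first.
  by move=> a ax; apply/funext => n; exact: uniq.
apply/cvgrPdist_lt => eps eps0; exists [:: eps^-1 *: x], 0%N => m _ H.
have /= := H (eps^-1 *: x); rewrite mem_head => /(_ isT).
under [fun n => _]funext do rewrite linearZ /=.
rewrite partial_sumZ -scalerBr normrZ gtr0_norm ?invr_gt0//.
by rewrite ltr_pdivrMl// mulr1.
Qed.

(** The failure of each strict premise is a closed condition, so the implication is a finite union
    of closed sets. *)
Lemma closed_finite_implication (S : topologicalType) (phi : nat -> S -> R)
    (P : set S) (n : nat) :
  (forall j, continuous (phi j)) -> closed P ->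
  closed [set s | (forall j, (j < n)%N -> phi j s < 1) -> P s].
Proof.
move=> cphi clP; elim: n => [|n IH].
  by rewrite (_ : [set _ | _] = P)//; apply/seteqP; split => s //= H; exact: H.
rewrite (_ : [set _ | _] = [set s | (forall j, (j < n)%N -> phi j s < 1) -> P s] `|`
    [set s | 1 <= phi n s]).
  by apply: closedU => //; exact: closed_ge_const.
apply/seteqP; split => s /=.
  move=> H; have [h1|h1] := leP 1 (phi n s); [by right|left => Hn; apply: H => j].
  by rewrite ltnS leq_eqVlt => /orP[/eqP->//|]; exact: Hn.
by move=> [H Hn|h1 /(_ n (ltnSn n))]; [apply: H => j jn; apply: Hn; exact: ltnW|rewrite ltNge h1].
Qed.

(** The finite list of vectors is read through [g] from the slices of one witness [b]; continuity of
    the functionals makes the expansions continuous in [b]. Length and threshold cost two countable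
    unions. *)
Lemma expansion_filter_analytic (g : baire_space -> X) :
  continuous g -> (forall x, exists b, g b = x) ->
  (forall n, continuous (esharp n : X -> R)) -> analytic_filter expansion_filter.
Proof.
move=> cg sg ce; apply: suslin_analytic.
pose phi m j (b : baire_space) : R := `|g (slice j b) - expansion (g (slice j b)) m|.
have cphi m j : continuous (phi m j).
  have cgs : continuous (g \o slice j) by apply: continuous_compose => //; exact: slice_continuous.
  apply: continuous_norm; apply: continuous_sub => //.
  apply: (@continuous_partial_sum _ _ _ e (fun n b => esharp n (g (slice j b)))) => n.
  by apply: (@continuous_compose _ _ _ (esharp n) (g \o slice j)).
rewrite (_ : in_cantor _ = \bigcup_n \bigcup_k [set A : cantor_space | exists b : baire_space,
    forall m, (k <= m)%N -> (forall j, (j < n)%N -> phi m j b < 1) -> A m]).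
  apply: bigcup_suslin => n; apply: bigcup_suslin => k.
  exists (\bigcap_(m in [set m | (k <= m)%N]) [set p : baire_space * cantor_space |
    (forall j, (j < n)%N -> phi m j p.1 < 1) -> p.2 m = true]); split.
    apply: closed_bigI => m _; apply: (@closed_finite_implication _ (fun j p => phi m j p.1)).
      by move=> j; apply: (@continuous_compose _ _ _ (phi m j) fst) => //; exact: fst_continuous.
    apply: closed_bool_eq; last exact: cst_continuous.
    by apply: (@continuous_coord _ (fun=> bool) snd m); exact: snd_continuous.
  by apply/seteqP; split => A [b H]; exists b => m; exact: H.
apply/seteqP; split => A.
  move=> [l [k H]]; exists (size l) => //; exists k => //.
  have /choice[b Hb] : forall j, exists b, g b = nth 0 l j by move=> j; exact: sg.
  exists (unslice b) => m km Hl; apply: (H m km) => x xl.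
  have := Hl (index x l); rewrite index_mem => /(_ xl).
  by rewrite /phi unsliceK Hb nth_index.
move=> [n _ [k _ [b H]]]; exists (mkseq (fun j => g (slice j b)) n), k => m km Hl.
by apply: H => // j jn; apply: Hl; apply: map_f; rewrite mem_iota.
Qed.

(** * Continuity from an analytic compatible filter *)

Lemma compatible_separable (F : set_system nat) : compatible e esharp F ->
  exists d : nat -> X, forall (x : X) (eps : R), 0 < eps -> exists i, `|x - d i| < eps.
Proof.
move=> cF; have [[FP _] _ _] := cF; apply: (@span_dense_sequence _ _ e) => x eps eps0.
have [m xm] := filter_ex (compatible_near x cF eps0).
by exists (fun n => esharp n x), m.
Qed.

(** The witness codes coefficients [a] and, for each [j], a member [w j] of [F] on which the partial
    sums are within [j.+1%:R^-1] of [x]. These closed conditions force convergence along [F], so [a]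
    is the coefficient sequence of [x]. *)
Lemma suslin_coordinate_level (F : set_system nat) (k : nat) (N : R) :
  compatible e esharp F -> suslin (in_cantor F) -> suslin [set x | `|esharp k x| <= N].
Proof.
move=> cF /suslin_analytic[F0|[f [cf fF]]]; have [[FP cofF] bF coordF] := cF.
  have : in_cantor F (fun=> true) by apply: (@filterS _ F _ setT) => //; exact: filterT.
  by rewrite F0.
have [dR dRd] := real_dense_sequence R.
have [g [cg sg]] := separable_continuous_image dRd.
pose a n (b : baire_space) : R := g (slice n (slice 0 b)).
have ca n : continuous (a n).
  apply: (@continuous_compose _ _ _ g (slice n \o slice 0)) => //.
  by apply: continuous_compose; exact: slice_continuous.
pose w j (b : baire_space) : cantor_space := f (slice j (slice 1 b)).
have cw j : continuous (w j).
  apply: (@continuous_compose _ _ _ f (slice j \o slice 1)) => //.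
  by apply: continuous_compose; exact: slice_continuous.
exists ([set p : baire_space * X | `|a k p.1| <= N] `&`
  \bigcap_j \bigcap_m ([set p : baire_space * X | w j p.1 m = false] `|`
    [set p | `|p.2 - partial_sum e (a ^~ p.1) m| <= j.+1%:R^-1])); split.
  apply: closedI.
    apply: closed_le_const; apply: continuous_norm.
    by apply: (@continuous_compose _ _ _ (a k) fst) => //; exact: fst_continuous.
  apply: closed_bigI => j _; apply: closed_bigI => m _; apply: closedU.
    apply: closed_bool_eq; last exact: cst_continuous.
    apply: (@continuous_coord _ (fun=> bool) (w j \o fst) m).
    by apply: continuous_compose => //; exact: fst_continuous.
  apply: closed_le_const; apply: continuous_norm; apply: continuous_sub.
    exact: snd_continuous.
  apply: (@continuous_partial_sum _ _ _ e (fun n p => a n p.1)) => n.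
  by apply: (@continuous_compose _ _ _ (a n) fst) => //; exact: fst_continuous.
apply/seteqP; split => x /=.
  move=> xN.
  have /choice[b0 Hb0] : forall n, exists b, g b = esharp n x by move=> n; exact: sg.
  have /choice[b1 Hb1] : forall j : nat, exists b, forall m, f b m ->
      `|x - expansion x m| <= j.+1%:R^-1.
    move=> j; have j0 : 0 < j.+1%:R^-1 :> R by rewrite invr_gt0 ltr0n.
    have : in_cantor F (fun m => `[< `|x - expansion x m| <= j.+1%:R^-1 >]).
      apply: filterS (compatible_near x cF j0) => m /= xm.
      by apply/asboolP; exact: ltW.
    by rewrite -fF => -[b _ fb]; exists b => m; rewrite fb => /asboolP.
  pose b := unslice (fun i => if i is 0%N then unslice b0 else unslice b1).
  have ab n : a n b = esharp n x by rewrite /a !unsliceK.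
  have abE : a ^~ b = fun n => esharp n x by apply/funext.
  exists b; split; first by rewrite /= ab.
  move=> j _ m _ /=; rewrite abE /w !unsliceK.
  by case E : (f (b1 j) m); [right; apply: Hb1; rewrite E|left].
move=> [b [/= bN H]]; suff -> : esharp k x = a k b by [].
apply: (coordF x (a ^~ b)).
apply/cvgrPdist_lt => eps /exists_invS_lt[j je].
have : in_cantor F (w j b) by rewrite -fF; exists (slice j (slice 1 b)).
apply: filterS => m /= wm; have [/=|/= xm] := H j I m I; first by rewrite wm.
exact: le_lt_trans xm je.
Qed.

Lemma suslin_continuous (F : set_system nat) :
  compatible e esharp F -> suslin (in_cantor F) ->
  forall n, continuous (esharp n : X -> R).
Proof.
move=> cF sF k; have [d dd] := compatible_separable cF.
pose A (N : nat) := [set x | `|esharp k x| <= N%:R].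
have [N nmA] : exists N, ~ meager (A N).
  apply/existsNP => mA; apply: (open_not_meager (openT : open [set: X])); first by exists 0.
  apply: sub_meager (meager_bigcup mA) => x _.
  by exists (Num.bound `|esharp k x|) => //; exact/ltW/archi_boundP/normr_ge0.
have [C [clC AC]] := suslin_coordinate_level k N%:R cF sF.
rewrite -/(A N) in AC; rewrite AC in nmA.
have [V [oV [x0 Vx0] mV]] := nonmeager_projection_comeager dd clC nmA.
rewrite -AC in mV.
have /nbhs_ballP[r /= r0 rV] : nbhs x0 V by exact: open_nbhs_nbhs.
have r20 : 0 < r / 2 by rewrite divr_gt0.
apply: (@scalar_bounded_continuous _ _ _ (r / 2) (N%:R + N%:R)) => //.
move=> h hr.
(* Near [x0] both [x] and [x + h] stay in [V]; the points where one of them leaves [A N] are meager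
   and cannot fill a ball. Then [h] is a difference of two points of [A N], whence the bound
   [N + N]. *)
have [x [Ax Axh]] : exists x, A N x /\ A N (x + h).
  apply: contrapT => nx.
  apply: (@open_not_meager _ _ (ball x0 (r / 2))).
  - exact: ball_open.
  - by exists x0; exact: ballxx.
  apply: sub_meager (meagerU mV (meager_translate h mV)) => x.
  rewrite -ball_normE /= => xr.
  have Vx : V x by apply: rV; rewrite -ball_normE /=; lra.
  have Vxh : V (x + h).
    apply: rV; rewrite -ball_normE /= opprD addrA.
    by apply: le_lt_trans (ler_normB _ _) _; lra.
  have [Ax|nAx] := pselect (A N x); last by left.
  by right; split => // Axh; apply: nx; exists x.
have -> : h = (x + h) - x by rewrite addrC addKr.
by rewrite linearB; apply: le_trans (ler_normB _ _) _; apply: lerD.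
Qed.

End filter_basis_system.

Theorem theorem1p18 (R : realType) (X : completeNormedModType R)
    (e : nat -> X) (esharp : nat -> {scalar X})
    (hsys : filter_basis_system e esharp) :
  [<-> (forall n : nat, continuous (esharp n : X -> R));
       minimal_sequence e;
       (exists F : set_system nat,
          smallest_compatible e esharp F /\ analytic_filter F);
       (exists F : set_system nat, compatible e esharp F /\ analytic_filter F);
       (exists F : set_system nat, compatible e esharp F /\ borel_filter F)].
Proof.
have [bi [F0 cF0]] := hsys.
tfae.
- exact: continuous_minimal.
- move=> me; have ce := minimal_continuous cF0 me.
  have [d dd] := compatible_separable cF0.
  have [g [cg sg]] := separable_continuous_image dd.
  exists (expansion_filter e esharp); split; last exact: expansion_filter_analytic cg sg ce.
  split; first exact: expansion_filter_compatible cF0.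
  by move=> G; exact: expansion_filter_sub.
- by move=> [F [[cF _] aF]]; exists F.
(* The analytic filter already forces continuity. Along the larger Borel filter [G] expansions still
   converge, and continuity gives uniqueness of their coefficients. *)
- move=> [F [cF aF]]; have ce := suslin_continuous cF (analytic_suslin aF).
  have [FF _ _] := cF.
  have [G [GG bG FG]] := analytic_filter_sub_borel FF aF.
  exists G; split => //.
  have coordG := continuous_coordinate_limit bi GG ce.
  split => // x; exists (fun n => esharp n x); split.
    by move=> U /(compatible_cvg (x := x) cF) /FG.
  by move=> a ax; apply/funext => n; exact: coordG.
- by move=> [F [cF bF]]; exact: suslin_continuous cF (borel_bisuslin bF).1.
Qed.
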